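(* Every tall analytic P-ideal on $\omega$ is not locally rapid.
   Context: Ideals on $\omega$ are assumed proper and to contain all finite sets. An ideal $\mathscr I$ on $\omega$ is tall if every infinite subset of $\omega$ contains an infinite set in $\mathscr I$; it is a P-ideal if for every countable $\overline A\subseteq\mathscr I$ there is $B\in\mathscr I$ such that $A\setminus B$ is finite for all $A\in\overline A$; it is analytic if it is an analytic subset of $\mathcal P(\omega)\cong2^\omega$. Given a partition $\bar P=(P_i)_{i<\omega}$ of $\omega$ (pieces are allowed to be empty), $A\subseteq\omega$ is a linear selector of $\bar P$ if $|A\cap P_i|\le i$ for all $i<\omega$. An ideal $\mathscr I$ on $\omega$ is locally rapid if for every partition $\bar P=(P_i)_{i<\omega}$ of $\omega$ into finite sets there is a linear selector $A$ of $\bar P$ with $A\notin\mathscr I$. *)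

(* Defs.v *)
From HB Require Import structures.
From mathcomp Require Import all_boot.
From mathcomp Require Import boolp classical_sets functions cardinality.
From mathcomp Require Import reals topology cantor.

Set Implicit Arguments.
Unset Strict Implicit.
Unset Printing Implicit Defensive.

Local Open Scope classical_set_scope.
Local Open Scope card_scope.

Record ideal (I : set (set nat)) : Prop := Ideal {
  ideal_fin : forall A, finite_set A -> I A;
  ideal_sub : forall A B, A `<=` B -> I B -> I A;
  ideal_setU : forall A B, I A -> I B -> I (A `|` B);
  ideal_proper : ~ I [set: nat]
}.

Definition tall (I : set (set nat)) : Prop :=
  forall A, infinite_set A -> exists B, [/\ B `<=` A, infinite_set B & I B].

Definition P_ideal (I : set (set nat)) : Prop :=
  forall AA : set (set nat), countable AA -> AA `<=` I ->
    exists2 B, I B & forall A, AA A -> finite_set (A `\` B).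

(* nat carries its discrete topology *)
Definition baire_space : topologicalType := prod_topology (fun _ : nat => nat).

Definition analytic (X : topologicalType) (S : set X) : Prop :=
  S = set0 \/ exists2 f : baire_space -> X, continuous f & range f = S.

(* P(omega) is identified with 2^omega through characteristic functions *)
Definition analytic_ideal (I : set (set nat)) : Prop :=
  analytic [set x : cantor_space | I [set n | x n]].

(* the pieces of P may be empty, unlike in classical_sets.partition *)
Definition omega_partition (P : nat -> set nat) : Prop :=
  trivIset [set: nat] P /\ \bigcup_i P i = [set: nat].

Definition linear_selector (P : nat -> set nat) (A : set nat) : Prop :=
  forall i, A `&` P i #<= `I_i.

Definition locally_rapid (I : set (set nat)) : Prop :=
  forall P : nat -> set nat, omega_partition P ->
    (forall i, finite_set (P i)) ->
    exists2 A, linear_selector P A & ~ I A.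

(* Main.v *)
Require Import Defs.
From mathcomp Require Import all_boot.
From mathcomp Require Import boolp classical_sets functions cardinality.
From mathcomp Require Import topology cantor.

Set Implicit Arguments.
Unset Strict Implicit.
Unset Printing Implicit Defensive.

Local Open Scope classical_set_scope.
Local Open Scope card_scope.

(* Write I as the range of a continuous F on the Baire space and call a set D of
   branches cofinal if every A in I is almost contained in F x for some x in D.
   As I is a P-ideal, a countable partition of a cofinal set has a cofinal part;
   as I is tall, for each i there is a k such that restricting a cofinal D to
   the x with a included in F x keeps it cofinal for all a of size <= i beyond
   k. Hence the pieces [k_i, k_(i+1)) can be chosen so that, for every linear
   selector A, a fusion shrinking cofinal sets converges to a branch x with the
   A-part of the pieces contained in F x. The threshold after meeting piece i is
   only known once k_(i+1) is, so pieces of even and odd index are treated by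
   separate fusions, and A is covered by two members of I. *)

(** * Cofinal sets of branches, and captures by tallness *)

Section Cofinal.
Variable I : set (set nat).
Hypotheses (idealI : ideal I) (tallI : tall I) (PI : P_ideal I).

Definition cofinal (T : Type) (F : T -> set nat) (D : set T) : Prop :=
  forall A, I A -> exists2 x, D x & finite_set (A `\` F x).

Lemma P_ideal_seq (A : nat -> set nat) : (forall m, I (A m)) ->
  exists2 B, I B & forall m, finite_set (A m `\` B).
Proof.
move=> IA; have [||B IB AB] := PI (AA := range A).
- by apply: card_le_trans (card_image_le _ _) _; exact: countableP.
- by move=> _ [m _ <-].
- by exists B => // m; apply: AB; exists m.
Qed.

Lemma finite_setD_trans (A B C : set nat) :
  finite_set (A `\` B) -> finite_set (B `\` C) -> finite_set (A `\` C).
Proof.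
move=> fAB fBC; apply: (@sub_finite_set _ _ ((A `\` B) `|` (B `\` C))).
  by move=> n [An nCn]; have [Bn|nBn] := pselect (B n); [right|left].
by rewrite finite_setU.
Qed.

(** If every fiber failed, each value [v] would have a witness [A v] in [I]. A pseudo-union [B] of
    the witnesses is almost contained in some [F x], and then so is the witness for [g x]. *)
Lemma cofinal_fiber (T : Type) (F : T -> set nat) (D : set T) (g : T -> nat) :
  cofinal F D -> exists v, cofinal F (D `&` [set x | g x = v]).
Proof.
move=> cofD; apply: contrapT => /forallNP ncof.
have /choice[A IA] : forall v, exists A, I A /\
    forall x, D x -> g x = v -> ~ finite_set (A `\` F x).
  move=> v; have /existsNP[A /not_implyP[IA nA]] := ncof v.
  by exists A; split=> // x Dx gx fx; apply: nA; exists x.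
have [B IB AB] := P_ideal_seq (fun m => (IA m).1).
have [x Dx Bx] := cofD B IB.
exact: (IA (g x)).2 x Dx erefl (finite_setD_trans (AB _) Bx).
Qed.

Lemma finite_set_ltn (A : set nat) :
  finite_set A -> exists k, forall n, A n -> n < k.
Proof.
move=> /finite_seqP[s ->]; exists (\max_(n <- s) n).+1 => n /= sn.
by rewrite ltnS (big_rem n sn) leq_maxl.
Qed.

Lemma infinite_geq (J : set nat) k : infinite_set J -> exists2 j, J j & k <= j.
Proof.
move=> infJ; apply: contrapT => nJ; apply: infJ.
apply: (@sub_finite_set _ _ `I_k) (finite_II k) => j Jj /=.
by rewrite ltnNge; apply/negP => kj; apply: nJ; exists j.
Qed.

Lemma finite_image_geq (J : set nat) (g : nat -> nat) :
  (forall j, j <= g j) -> finite_set (g @` J) -> finite_set J.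
Proof.
move=> geg /finite_set_ltn[k gk].
apply: (@sub_finite_set _ _ `I_k) (finite_II k) => j Jj.
by apply: leq_ltn_trans (geg j) (gk _ _); exists j.
Qed.

(** Induction on the size bound: the tails are thinned first, then tallness is applied to the set of
    heads. *)
Lemma tall_thinning (i : nat) (t : nat -> seq nat) (J : set nat) :
  infinite_set J -> (forall j, size (t j) <= i) ->
  (forall j n, n \in t j -> j <= n) ->
  exists J', [/\ J' `<=` J, infinite_set J' & I (\bigcup_(j in J') [set` t j])].
Proof.
elim: i t J => [|i IHi] t J infJ sz_t get.
  exists J; split=> //; apply: ideal_fin => //.
  apply: (@sub_finite_set _ _ set0) (finite_set0 _) => n [j _] /=.
  by have := sz_t j; rewrite leqn0 size_eq0 => /eqP ->.
have [j|j n tn|J1 [J1J infJ1 IJ1]] := IHi (fun j => behead (t j)) J infJ.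
- by rewrite size_behead; have := sz_t j; case: size.
- by apply: get; exact: mem_behead.
(* The default [j] keeps [j <= g j] even when [t j] is empty, so [g] has infinite image on infinite
   sets. *)
pose g j := head j (t j).
have geg j : j <= g j.
  by rewrite /g; have := @get j; case: (t j) => //= a s; apply;
     rewrite mem_head.
have [|Y [YJ infY IY]] := tallI (A := g @` J1).
  by move=> fJ1; apply: infJ1; exact: finite_image_geq fJ1.
exists (J1 `&` g @^-1` Y); split.
- by move=> j [/J1J].
- move=> fJ'; apply: infY.
  apply: sub_finite_set (finite_image g fJ') => y Yy.
  by have [j J1j gjy] := YJ y Yy; exists j => //; split=> //=; rewrite gjy.
- apply: (ideal_sub idealI) (ideal_setU idealI IY IJ1) => n [j [J1j Yj] /= tn].
  have [<-|ngj] := eqVneq (g j) n; first by left.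
  right; exists j => //=; move: tn ngj; rewrite /g; case: (t j) => //= a s.
  by rewrite inE eq_sym => /orP[->|].
Qed.

Lemma card_le_seq (a : set nat) i : a #<= `I_i ->
  exists2 s : seq nat, a = [set` s] & size s <= i.
Proof.
move=> ai; have fa : finite_set a by apply/finite_set_leP; exists i.
exists (finmap.enum_fset (fset_set a)); last exact: geq_card_fset_set.
by apply/seteqP; split=> n; rewrite /= in_fset_set// inE.
Qed.

(* If thresholds failed, the offending finite sets could be thinned out to have
   their union in I; a member of the family almost containing that union
   contains one of them, against its choice. *)
Lemma cofinal_capture (T : Type) (F : T -> set nat) (D : set T) (i : nat) :
  cofinal F D -> exists k, forall a, a `<=` [set n | k <= n] -> a #<= `I_i ->
    cofinal F (D `&` [set x | a `<=` F x]).
Proof.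
move=> cofD; apply: contrapT => /forallNP nk.
have /choice[t tP] : forall k, exists s : seq nat, exists A : set nat,
    [/\ forall n, n \in s -> k <= n, size s <= i, I A &
     forall x, D x -> [set` s] `<=` F x -> ~ finite_set (A `\` F x)].
  move=> k; have /existsNP[a /not_implyP[ka /not_implyP[ai]]] := nk k.
  move=> /existsNP[A /not_implyP[IA nA]].
  have [s as_ szs] := card_le_seq ai; subst a.
  exists s, A; split=> // x Dx sx fx.
  by apply: nA; exists x.
have {tP}/choice[A AP] := tP.
have [|j|j n|J [_ infJ IJ]] := @tall_thinning i t setT.
- exact: infinite_nat.
- by have [] := AP j.
- by have [+ _ _ _] := AP j; apply.
have [B IB AB] := @P_ideal_seq A (fun j => let: And4 _ _ IA _ := AP j in IA).
have [x Dx fx] := cofD _ (ideal_setU idealI IB IJ).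
have [k kP] := finite_set_ltn fx.
have [j Jj kj] := infinite_geq k infJ.
have [jt _ _] := AP j; apply; first exact: Dx.
- move=> n /= tn; apply: contrapT => nFx.
  have : n < k by apply: kP; split=> //; right; exists j.
  by rewrite ltnNge (leq_trans kj)// jt.
- apply: finite_setD_trans (AB j) _; apply: sub_finite_set fx.
  by move=> n [Bn nF]; split=> //; left.
Qed.

(** * The fusion and the partition built from its thresholds *)

Section Fusion.
Variable F : (nat -> nat) -> set nat.
Hypotheses (IF : forall x, I (F x)) (cofF : cofinal F setT).
Hypothesis closedF : forall x n, exists j, forall y,
  (forall i, i < j -> y i = x i) -> F y n -> F x n.

(* A history lists finite sets, latest first; its j-th move adds one of them to
   the sets required to be contained in F x, and decides the coordinate x j. *)
Fixpoint fusion (h : seq (set nat)) : set (nat -> nat) :=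
  if h is a :: h' then
    let D := fusion h' `&` [set x | a `<=` F x] in
    D `&` [set x | x (size h') =
      xget 0 [set v | cofinal F (D `&` [set x | x (size h') = v])]]
  else setT.

(** After the history [h], the next piece met has index [(size h).*2 + p + 1] with [p <= 1]; this
    explains the bound on the size of [a]. *)
Definition threshold (h : seq (set nat)) : nat :=
  xget 0 [set k | forall a, a `<=` [set n | k <= n] ->
    a #<= `I_(size h).*2.+2 -> cofinal F (fusion h `&` [set x | a `<=` F x])].

Lemma cofinal_fusion_cons h a : cofinal F (fusion h) ->
  a `<=` [set n | threshold h <= n] -> a #<= `I_(size h).*2.+2 ->
  cofinal F (fusion (a :: h)).
Proof.
move=> cofh ha sza.
have cofa : cofinal F (fusion h `&` [set x | a `<=` F x]).
  by have := xgetPex 0 (cofinal_capture (size h).*2.+2 cofh); apply.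
exact: (xgetPex 0 (cofinal_fiber (fun x => x (size h)) cofa)).
Qed.

Definition set_of_bits (s : seq bool) : set nat := [set n | nth false s n].

(** Bit tuples code the subsets of [I_m], so the maximum runs over the finitely many histories of at
    most [m] such sets, whatever the selector. *)
Definition next_cut (m : nat) : nat :=
  maxn m.+1 (\max_(h : m.-bseq (m.-tuple bool))
    threshold [seq set_of_bits (t : m.-tuple bool) | t <- h]).

Lemma threshold_next_cut m h : size h <= m -> {in h, forall a, a `<=` `I_m} ->
  threshold h <= next_cut m.
Proof.
move=> szh hm.
pose bits (a : set nat) : m.-tuple bool :=
  [tuple of [seq `[< a i >] | i <- iota 0 m]].
have szb : size (map bits h) <= m by rewrite size_map.
suff -> : h = [seq set_of_bits (t : m.-tuple bool) | t <- Bseq szb].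
  by rewrite leq_max; apply/orP; right; exact: leq_bigmax.
rewrite /= -map_comp; apply/esym; rewrite -[RHS]map_id.
apply/eq_in_map => a ah /=; rewrite /set_of_bits; apply/seteqP; split=> n /=.
- have [mn|nm] := leqP m n; first by rewrite nth_default ?size_map ?size_iota.
  by rewrite (nth_map 0) ?size_iota// nth_iota// add0n => /asboolP.
- move=> an; have nm : n < m := hm _ ah _ an.
  by rewrite (nth_map 0) ?size_iota// nth_iota//; apply/asboolP.
Qed.

Definition cut (i : nat) : nat := iter i next_cut 0.

Lemma cut_ltS i : cut i < cut i.+1. Proof. by rewrite leq_max leqnn. Qed.

Lemma leq_cut i j : i <= j -> cut i <= cut j.
Proof.
by apply: homo_leq leqnn leq_trans _ i j => i; exact: ltnW (cut_ltS i).
Qed.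

Lemma cut_geq i : i <= cut i.
Proof. by elim: i => // i /leq_ltn_trans; apply; exact: cut_ltS. Qed.

Definition piece (i : nat) : set nat := [set n | cut i <= n < cut i.+1].

Lemma omega_partition_piece : omega_partition piece.
Proof.
split; last first.
  apply/seteqP; split=> // n _.
  have ex : exists i, n < cut i by exists n.+1; exact: cut_geq.
  case: (ex_minnP ex) => [[//|i] ni mini]; exists i => //=.
  by rewrite /piece /= ni andbT leqNgt; apply/negP => /mini; rewrite ltnn.
move=> i j _ _ [n [/andP[in_ ni] /andP[jn nj]]].
have [ij|ji|//] := ltngtP i j.
- by have := leq_cut ij; rewrite leqNgt (leq_ltn_trans jn ni).
- by have := leq_cut ji; rewrite leqNgt (leq_ltn_trans in_ nj).
Qed.

(** The parity [p] leaves a gap: the first [j] moves live below [cut (j.*2 + p)], while the next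
    piece starts one cut later, beyond their threshold. *)
Fixpoint history (p : nat) (A : set nat) (j : nat) : seq (set nat) :=
  if j is j'.+1 then (A `&` piece (j'.*2 + p).+1) :: history p A j' else [::].

Lemma size_history p A j : size (history p A j) = j.
Proof. by elim: j => //= j ->. Qed.

Lemma history_sub p A j :
  {in history p A j, forall a, a `<=` `I_(cut (j.*2 + p))}.
Proof.
elim: j => // j IHj a; rewrite inE => /orP[/eqP ->|/IHj aj] n.
  by move=> [_ /andP[_]]; rewrite doubleS.
move=> an; apply: leq_trans (aj _ an) (leq_cut _).
by rewrite leq_add2r leq_double.
Qed.

Lemma cofinal_history p A j : p <= 1 -> linear_selector piece A ->
  cofinal F (fusion (history p A j)).
Proof.
move=> p1 selA; elim: j => [|j IHj]; first exact: cofF.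
apply: cofinal_fusion_cons => //.
  move=> n [_ /andP[+ _]]; apply: leq_trans.
  apply: threshold_next_cut; last exact: history_sub.
  rewrite size_history; apply: leq_trans (cut_geq (j.*2 + p)).
  by rewrite -addnn -addnA leq_addr.
rewrite size_history; apply: card_le_trans (selA _) _.
by rewrite card_le_II ltnS -addn1 leq_add2l.
Qed.

Lemma selector_half_in p A : p <= 1 -> linear_selector piece A ->
  I (A `&` \bigcup_j piece (j.*2 + p).+1).
Proof.
move=> p1 selA.
(* The limit branch: its coordinate [j] is the value fixed by move [j]. *)
pose x j := xget 0 [set v | cofinal F
  ((fusion (history p A j) `&`
    [set x | A `&` piece (j.*2 + p).+1 `<=` F x]) `&` [set x | x j = v])].
have fus_x j y : fusion (history p A j) y -> forall i, i < j -> y i = x i.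
  elim: j => //= j IHj [[/IHj yx _]]; rewrite size_history => yj i.
  by rewrite ltnS leq_eqVlt => /orP[/eqP ->|/yx].
have fus_sub j y : fusion (history p A j) y ->
    forall i, i < j -> A `&` piece (i.*2 + p).+1 `<=` F y.
  elim: j => //= j IHj [[/IHj yA yj] _] i.
  by rewrite ltnS leq_eqVlt => /orP[/eqP ->|/yA].
apply: (ideal_sub idealI) (IF x) => n [An [i _ pn]].
have [j jP] := closedF x n.
(* Cofinality, applied to the empty set, yields a point [y]. Enough moves are made for [y] to agree
   with [x] below [j] and to have captured the [i]-th set. *)
have [y Dy _] := cofinal_history (maxn j i.+1) p1 selA
  (ideal_fin idealI (finite_set0 _)).
apply: (jP y).
- by move=> l lj; apply: fus_x Dy _ _; rewrite leq_max lj.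
- by apply: (fus_sub _ _ Dy i) => //; rewrite ?leq_max ?leqnn ?orbT.
Qed.

Lemma selector_in A : linear_selector piece A -> I A.
Proof.
move=> selA; have := ideal_setU idealI (selector_half_in (leq0n 1) selA)
  (selector_half_in (leqnn 1) selA).
apply: (ideal_sub idealI) => n An.
have [_ /seteqP[_ /(_ n Logic.I)[i _ pn]]] := omega_partition_piece.
case: i pn => [|i] pn.
  (* Neither half covers piece 0, but a linear selector misses it. *)
  have /card_le0P A0 : A `&` piece 0 #<= @set0 nat
    by have := selA 0; rewrite II0.
  by have : (A `&` piece 0) n by []; rewrite A0.
rewrite -[i]odd_double_half addnC in pn.
by case: (odd i) pn => pn; [right|left]; split=> //; exists i./2.
Qed.

Lemma fusion_not_locally_rapid : ~ locally_rapid I.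
Proof.
move=> /(_ piece omega_partition_piece)[|A selA];
  last by apply; exact: selector_in.
move=> i; apply: (@sub_finite_set _ _ `I_(cut i.+1)) (finite_II _) => n.
by move=> /andP[].
Qed.

End Fusion.

End Cofinal.

(** * From an analytic ideal to a continuous [F] *)

Lemma continuous_cantor_coord (f : baire_space -> cantor_space)
    (x : baire_space) n :
  continuous f ->
  exists j, forall y : baire_space, (forall i, i < j -> y i = x i) ->
    f y n = f x n.
Proof.
move=> cf; apply: contrapT => /forallNP nj.
have /choice[y yP] : forall j, exists y : baire_space,
    (forall i, i < j -> y i = x i) /\ f y n <> f x n.
  by move=> j; have /existsNP[y /not_implyP] := nj j; exists y.
(* Agreement on ever longer initial segments is convergence in the product; by continuity bit [n] of
   [f (y j)] is eventually [f x n], against the choice of [y]. *)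
have yx : y @ \oo --> x.
  apply/cvg_sup => N U [V] [[W] oW <-] WxN WU.
  apply: (filterS WU); rewrite nbhs_simpl; exists N.+1 => // i /= Ni.
  by rewrite /= (yP i).1.
have : (fun j => f (y j) n) @ \oo --> f x n.
  apply: (@cvg_comp _ _ _ (fun j => f (y j)) (fun g : cantor_space => g n)
    _ (nbhs (f x))).
    by apply: (@cvg_comp _ _ _ y f _ (nbhs x)) => //; exact: cf.
  exact: (@proj_continuous nat (fun _ => bool) n (f x)).
move=> /(_ [set f x n] (discrete_set1 _)) [N _ /(_ N (leqnn N))].
exact: (yP N).2.
Qed.

Theorem proposition6p15 (I : set (set nat)) (idealI : ideal I)
  (tallI : tall I) (analyticI : analytic_ideal I) (PI : P_ideal I) :
  ~ locally_rapid I.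
Proof.
have rep A : [set n | `[< A n >]] = A.
  by apply/seteqP; split=> n /= /asboolP.
have [S0|[f cf fS]] := analyticI.
  have : [set x : cantor_space | I [set n | x n]] (fun n => `[< set0 n >]).
    by rewrite /= rep; apply: ideal_fin.
  by rewrite S0.
pose F (x : nat -> nat) : set nat := [set n | f x n].
apply: (@fusion_not_locally_rapid I idealI tallI PI F).
- move=> x; have : range f (f x) by exists x.
  by rewrite fS.
- move=> A IA.
  have : [set x : cantor_space | I [set n | x n]] (fun n => `[< A n >]).
    by rewrite /= rep.
  rewrite -fS => -[x _ fx]; exists x => //.
  by rewrite /F fx rep setDv; exact: finite_set0.
- move=> x n; have [j jP] := continuous_cantor_coord x n cf.
  by exists j => y yx; rewrite /F /= (jP y yx).
Qed.
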